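(* For all integers $N\ge 1$ and $n\ge 0$, $$\sum_{\substack{i_1+i_2+i_3=n\\ i_1,i_2,i_3\ge 0}}\binom{n}{i_1,i_2,i_3}E_{N,i_1}E_{N,i_2}E_{N,i_3}=\sum_{m=0}^n\sum_{k=0}^m\binom{n}{m}\binom{m}{k}\frac{(4N-m)(2N-k)}{8N^2}E_{N,k}\,\widehat E_{N-1,n-m}\,\widehat E_{N-1,m-k}.$$
   Context: $\binom{n}{i_1,i_2,i_3}=\frac{n!}{i_1!i_2!i_3!}$. For an integer $N\ge 0$, the hypergeometric Euler numbers $E_{N,n}$ are defined by $\dfrac{1}{\sum_{m\ge 0}\frac{(2N)!}{(2N+2m)!}t^{2m}}=\sum_{n=0}^\infty E_{N,n}\frac{t^n}{n!}$ (the denominator equals ${}_1F_2(1;N+1,\tfrac{2N+1}{2};\tfrac{t^2}{4})$). For an integer $M\ge 0$, the complementary hypergeometric Euler numbers $\widehat E_{M,n}$ are defined by $$\frac{t^{2M+1}/(2M+1)!}{\sinh t-\sum_{m=0}^{M-1}t^{2m+1}/(2m+1)!}=\sum_{n=0}^\infty\widehat E_{M,n}\frac{t^n}{n!},$$ equivalently $1/\sum_{m\ge0}\frac{(2M+1)!}{(2M+2m+1)!}t^{2m}=\sum_n\widehat E_{M,n}t^n/n!$. *)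

(* Defs.v *)
From mathcomp Require Import all_boot all_order all_algebra.

Set Implicit Arguments.
Unset Strict Implicit.
Unset Printing Implicit Defensive.

Import GRing.Theory.
Local Open Scope ring_scope.

(* A formal power series is its sequence of coefficients, and equality of      *)
(* series is pointwise equality [=1].                                          *)
Definition fps := nat -> rat.

Definition fps_one : fps := fun n => (n == 0)%:R.

Definition fps_monom (c : rat) (d : nat) : fps := fun n => c *+ (n == d).

Definition fps_mul (f g : fps) : fps :=
  fun n => \sum_(i < n.+1) f (n - i)%N * g i.

(* [fps_inv_seq f n] lists the first n coefficients of 1 / f; f 0 must be      *)
(* nonzero for this to be meaningful (see [fps_mulV]).                         *)
Fixpoint fps_inv_seq (f : fps) (n : nat) : seq rat :=
  if n is n'.+1 then
    let s := fps_inv_seq f n' in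
    rcons s ((f 0)^-1 * (fps_one n' - \sum_(i < n') f (n' - i)%N * s`_i))
  else [::].

Definition fps_inv (f : fps) : fps := fun n => (fps_inv_seq f n.+1)`_n.

Definition fps_shift (d : nat) (f : fps) : fps := fun n => f (d + n)%N.

(* The quotient f / g of two series divisible by t ^ d, where d is the exact   *)
(* order of g: cancel t ^ d, then divide (see [fps_mul_div]).                  *)
Definition fps_div (d : nat) (f g : fps) : fps :=
  fps_mul (fps_inv (fps_shift d g)) (fps_shift d f).

Lemma size_fps_inv_seq f n : size (fps_inv_seq f n) = n.
Proof. by elim: n => //= n IHn; rewrite size_rcons IHn. Qed.

Lemma nth_fps_inv_seq f n i : (i < n)%N -> (fps_inv_seq f n)`_i = fps_inv f i.
Proof.
elim: n => // n IHn; rewrite ltnS leq_eqVlt => /predU1P[->//|lt_in].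
by rewrite /= nth_rcons size_fps_inv_seq lt_in IHn.
Qed.

Lemma fps_invE f n :
  fps_inv f n =
  (f 0) ^-1 * (fps_one n - \sum_(i < n) f (n - i)%N * fps_inv f i).
Proof.
rewrite {1}/fps_inv /= nth_rcons size_fps_inv_seq ltnn eqxx.
by congr (_ * (_ - _)); apply: eq_bigr => i _; rewrite nth_fps_inv_seq.
Qed.

Lemma fps_mulV f : f 0 != 0 -> fps_mul f (fps_inv f) =1 fps_one.
Proof.
move=> f0 n; rewrite /fps_mul big_ord_recr /= subnn [in X in _ + X]fps_invE.
by rewrite mulrA divff // mul1r addrC subrK.
Qed.

Lemma fps_mulA f g h : fps_mul f (fps_mul g h) =1 fps_mul (fps_mul f g) h.
Proof.
pose P (u : fps) m : {poly rat} := \poly_(i < m) u i.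
have PM u v m i : (i < m)%N -> fps_mul u v i = (P u m * P v m)`_i.
  move=> im; rewrite coefMr; apply: eq_bigr => j _; rewrite !coef_poly.
  by rewrite (leq_ltn_trans (leq_subr _ _) im) (leq_ltn_trans _ im) // -ltnS.
move=> n; transitivity ((P f n.+1 * (P g n.+1 * P h n.+1))`_n).
  rewrite coefMr /fps_mul; apply: eq_bigr => i _.
  rewrite coef_poly ltnS leq_subr; congr (_ * _); rewrite -PM //.
rewrite mulrA coefMr /fps_mul; apply: eq_bigr => i _.
by rewrite coef_poly ltn_ord; congr (_ * _); rewrite -PM // ltnS leq_subr.
Qed.

Lemma eq_fps_mul f f' g g' : f =1 f' -> g =1 g' -> fps_mul f g =1 fps_mul f' g'.
Proof. by move=> ff gg n; apply: eq_bigr => i _; rewrite ff gg. Qed.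

Lemma fps_mul1 f : fps_mul fps_one f =1 f.
Proof.
move=> n; rewrite /fps_mul big_ord_recr /= subnn mul1r big1 ?add0r // => i _.
by rewrite /fps_one subn_eq0 leqNgt ltn_ord mul0r.
Qed.

Lemma fps_mul_order d f g : (forall i, (i < d)%N -> f i = 0) ->
  forall n, fps_mul f g n =
    if (n < d)%N then 0 else fps_mul (fps_shift d f) g (n - d)%N.
Proof.
move=> f0 n; case: ltnP => [lt_nd | le_dn].
  by apply: big1 => i _; rewrite f0 ?mul0r // (leq_ltn_trans (leq_subr _ _)).
rewrite /fps_mul /fps_shift.
have le_n : ((n - d).+1 <= n.+1)%N by rewrite ltnS leq_subr.
rewrite (big_ord_widen _ (fun i => f (d + (n - d - i))%N * g i) le_n).
rewrite [LHS](bigID (fun i : 'I_n.+1 => (i < (n - d).+1)%N)) /=.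
rewrite [X in _ + X]big1 ?addr0 => [|i].
  by apply: eq_bigr => i; rewrite ltnS => le_i; rewrite addnBA // subnKC.
rewrite -leqNgt => lt_i; rewrite f0 ?mul0r //.
rewrite -(ltn_add2r i) subnK; last by rewrite -ltnS.
by rewrite -{1}(subnKC le_dn) ltn_add2l.
Qed.

Lemma fps_mul_div d f g :
  (forall i, (i < d)%N -> f i = 0) -> (forall i, (i < d)%N -> g i = 0) ->
  g d != 0 -> fps_mul g (fps_div d f g) =1 f.
Proof.
move=> f0 g0 gd n; rewrite (fps_mul_order _ g0); case: ltnP => [/f0->//|le_dn].
rewrite fps_mulA (eq_fps_mul (fps_mulV _) (frefl _)) ?fps_mul1.
  by rewrite /fps_shift subnKC.
by rewrite /fps_shift addn0.
Qed.

Lemma fps_mulI d g h h' : (forall i, (i < d)%N -> g i = 0) -> g d != 0 ->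
  fps_mul g h =1 fps_mul g h' -> h =1 h'.
Proof.
move=> g0 gd eq_gh n; elim/ltn_ind: n => n IHn.
have := eq_gh (d + n)%N; rewrite !(fps_mul_order _ g0) ltnNge leq_addr /= addKn.
rewrite /fps_mul !big_ord_recr /= subnn /fps_shift addn0.
rewrite (eq_bigr (fun i : 'I_n => g (d + (n - i))%N * h' i)) => [|i _].
  by move/addrI/(mulfI gd).
by rewrite IHn.
Qed.

Definition fps_egf (a : nat -> rat) : fps := fun n => a n / n`!%:R.

Definition of_egf (f : fps) : nat -> rat := fun n => n`!%:R * f n.

Lemma of_egfK f : fps_egf (of_egf f) =1 f.
Proof.
move=> n; rewrite /fps_egf /of_egf mulrC mulKf //.
by rewrite Num.Theory.pnatr_eq0 -lt0n fact_gt0.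
Qed.

(* sum_(m >= 0) (2N)! / (2N + 2m)! t^(2m) *)
Definition euler_den (N : nat) : fps :=
  fun i => if odd i then 0 else (2 * N)`!%:R / (2 * N + i)`!%:R.

Definition hyp_euler (N : nat) : nat -> rat := of_egf (fps_inv (euler_den N)).

Definition fps_sinh : fps := fun i => if odd i then (i`!%:R)^-1 else 0.

(* sinh t - sum_(m < M) t^(2m+1) / (2m+1)!, a series of order 2M+1 *)
Definition sinh_tail (M : nat) : fps := fun i =>
  fps_sinh i -
  \sum_(m < M) fps_monom ((2 * m + 1)`!%:R)^-1 (2 * m + 1)%N i.

Definition comp_euler (M : nat) : nat -> rat :=
  of_egf (fps_div (2 * M + 1)
            (fps_monom ((2 * M + 1)`!%:R)^-1 (2 * M + 1)%N) (sinh_tail M)).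

Lemma hyp_eulerP N (E : nat -> rat) :
  fps_mul (euler_den N) (fps_egf E) =1 fps_one <-> E =1 hyp_euler N.
Proof.
have nz n : n`!%:R != 0 :> rat by rewrite Num.Theory.pnatr_eq0 -lt0n fact_gt0.
have D0 : euler_den N 0 != 0 by rewrite /euler_den /= addn0 divff ?oner_eq0.
split=> [EP n | eqE n].
  have /(_ n): fps_egf E =1 fps_inv (euler_den N).
    by apply: (fps_mulI (d := 0) _ D0) => // i; rewrite EP fps_mulV.
  by rewrite /hyp_euler /of_egf => <-; rewrite /fps_egf mulrC divfK.
rewrite -(fps_mulV D0); apply: eq_fps_mul => // i.
by rewrite -[RHS]of_egfK /fps_egf eqE.
Qed.

Lemma sinh_tailE M i :
  sinh_tail M i = if odd i && (2 * M < i)%N then (i`!%:R)^-1 else 0.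
Proof.
rewrite /sinh_tail /fps_sinh; case: ifPn => [odd_i | even_i] /=; last first.
  rewrite big1 ?subr0 // => m _; rewrite /fps_monom; case: eqP => // ei.
  by move: even_i; rewrite ei oddD oddM.
have iE : i = (2 * i./2 + 1)%N.
  by rewrite -[LHS]odd_double_half odd_i addnC mul2n.
case: ltnP => lt_i.
  rewrite big1 ?subr0 // => m _; rewrite /fps_monom; case: eqP => // ei.
  by move: lt_i; rewrite ei addn1 ltnS leq_pmul2l // leqNgt ltn_ord.
have lt_M : (i./2 < M)%N.
  by move: lt_i; rewrite {1}iE addn1 ltn_pmul2l.
rewrite (bigD1 (Ordinal lt_M)) //= big1 ?addr0 => [|m neq_m].
  by rewrite /fps_monom -iE eqxx subrr.
rewrite /fps_monom; case: eqP => // ei; case/eqP: neq_m; apply: val_inj => /=.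
by apply/eqP; rewrite -(eqn_pmul2l (isT : 0 < 2)%N) -(eqn_add2r 1) -ei -iE.
Qed.

Lemma comp_eulerP M (E : nat -> rat) :
  fps_mul (sinh_tail M) (fps_egf E)
    =1 fps_monom ((2 * M + 1)`!%:R)^-1 (2 * M + 1)%N
  <-> E =1 comp_euler M.
Proof.
have nz n : n`!%:R != 0 :> rat by rewrite Num.Theory.pnatr_eq0 -lt0n fact_gt0.
have S0 i : (i < 2 * M + 1)%N -> sinh_tail M i = 0.
  by rewrite sinh_tailE addn1 ltnS leqNgt => /negPf->; rewrite andbF.
have SD : sinh_tail M (2 * M + 1)%N != 0.
  by rewrite sinh_tailE oddD oddM /= addn1 ltnSn invr_eq0.
set f := fps_monom _ _; have f0 i : (i < 2 * M + 1)%N -> f i = 0.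
  by rewrite /f /fps_monom => /ltn_eqF->.
split=> [EP n | eqE n].
  have /(_ n): fps_egf E =1 fps_div (2 * M + 1) f (sinh_tail M).
    by apply: (fps_mulI S0 SD) => i; rewrite EP fps_mul_div.
  by rewrite /comp_euler /of_egf => <-; rewrite /fps_egf mulrC divfK.
rewrite -[RHS](fps_mul_div f0 S0 SD); apply: eq_fps_mul => // i.
by rewrite -[RHS]of_egfK /fps_egf eqE.
Qed.

Definition trinomial (n i1 i2 i3 : nat) : rat :=
  n`!%:R / (i1`! * i2`! * i3`!)%:R.

(* Main.v *)
(** Let A and B be the denominators whose inverses E and F generate the numbers
    [hyp_euler N] and [comp_euler (N - 1)].  Comparing coefficients,
    (2N + t d/dt) A = 2N B.  For the operator T_c = c - t d/dt, the Leibniz rule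
    reads T_(a+b) (f g) = T_a f g + f T_b g.  Applied to A E = 1 it gives
    F T_(2N) E = 2N E^2, and applied to E E it gives T_(4N) (E^2) = 2 E T_(2N) E.
    Hence F T_(4N) (F T_(2N) E) = 8 N^2 E^3; the claim is its n-th coefficient. *)
Require Import Defs.
From mathcomp Require Import all_boot all_order all_algebra.
From mathcomp Require Import ring.
Import GRing.Theory.
Local Open Scope ring_scope.

Lemma fact_neq0 n : n`!%:R != 0 :> rat.
Proof. by rewrite Num.Theory.pnatr_eq0 -lt0n fact_gt0. Qed.

Definition fps_scale (c : rat) (f : fps) : fps := fun n => c * f n.

Definition fps_trunc (m : nat) (f : fps) : {poly rat} := \poly_(i < m) f i.

(** The coefficient of index [i] in a product involves only coefficients of index at most [i], so
    truncation at [m] loses nothing. Commutativity and the triple product can thus be read off in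
    [{poly rat}]. *)
Lemma coef_fps_trunc_mul m f g i : (i < m)%N ->
  (fps_trunc m f * fps_trunc m g)`_i = fps_mul f g i.
Proof.
move=> lt_im; rewrite coefMr; apply: eq_bigr => j _; rewrite !coef_poly.
by rewrite (leq_ltn_trans (leq_subr _ _) lt_im) (leq_ltn_trans _ lt_im) // -ltnS.
Qed.

Lemma fps_mulC f g : fps_mul f g =1 fps_mul g f.
Proof. by move=> n; rewrite -!(@coef_fps_trunc_mul n.+1) // mulrC. Qed.

Lemma fps_mulCA f g h :
  fps_mul f (fps_mul g h) =1 fps_mul g (fps_mul f h).
Proof.
move=> n; rewrite fps_mulA (eq_fps_mul (fps_mulC f g) (frefl h)).
by rewrite -fps_mulA.
Qed.

Lemma fps_mulZr c f g : fps_mul f (fps_scale c g) =1 fps_scale c (fps_mul f g).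
Proof.
by move=> n; rewrite /fps_scale mulr_sumr; apply: eq_bigr => i _; rewrite mulrCA.
Qed.

Lemma fps_mul3E f n :
  fps_mul f (fps_mul f f) n =
  \sum_(i1 < n.+1) \sum_(i2 < n.+1) \sum_(i3 < n.+1 | (i1 + i2 + i3)%N == n)
     f i1 * f i2 * f i3.
Proof.
have -> : fps_mul f (fps_mul f f) n =
    (fps_trunc n.+1 f * fps_trunc n.+1 f * fps_trunc n.+1 f)`_n.
  rewrite fps_mulA coefMr; apply: eq_bigr => i _.
  by rewrite coef_fps_trunc_mul ?ltnS ?leq_subr // coef_poly ltn_ord.
(* Each truncation is expanded into monomials; the product of three of them contributes to ['X^n]
   exactly when the exponents add up to [n]. *)
rewrite /fps_trunc poly_def big_distrlr /= mulr_suml coef_sum.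
apply: eq_bigr => i1 _; rewrite mulr_suml coef_sum; apply: eq_bigr => i2 _.
rewrite mulr_sumr coef_sum [RHS]big_mkcond; apply: eq_bigr => i3 _.
rewrite -!(scalerAl, scalerAr) -!exprD !coefZ coefXn eq_sym.
by case: eqP => _ /=; ring.
Qed.

(* The operator c - t d/dt. *)
Definition euler_op (c : rat) (f : fps) : fps := fun n => (c - n%:R) * f n.

Lemma eq_euler_op c f g : f =1 g -> euler_op c f =1 euler_op c g.
Proof. by move=> fg n; rewrite /euler_op fg. Qed.

(** Leibniz rule, termwise: a + b - n = (a - (n - i)) + (b - i). *)
Lemma euler_opM a b f g n :
  euler_op (a + b) (fps_mul f g) n =
  fps_mul (euler_op a f) g n + fps_mul f (euler_op b g) n.
Proof.
rewrite /euler_op /fps_mul mulr_sumr -big_split; apply: eq_bigr => i _ /=.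
by rewrite natrB; [ring | rewrite -ltnS].
Qed.

Lemma euler_op_one : euler_op 0 fps_one =1 fun=> 0.
Proof. by case=> [|n]; rewrite /euler_op /fps_one ?subrr ?mul0r ?mulr0. Qed.

(* sum_(m >= 0) (2M+1)! / (2M + 1 + 2m)! t^(2m) *)
Definition comp_den (M : nat) : fps := fun i =>
  if odd i then 0 else (2 * M + 1)`!%:R / (2 * M + 1 + i)`!%:R.

(** Cancelling t^(2M+1) in the equation that defines [comp_euler] leaves a denominator with nonzero
    constant term, which [comp_den] normalises to 1. *)
Lemma comp_denV M : fps_mul (comp_den M) (fps_egf (comp_euler M)) =1 fps_one.
Proof.
have tail0 i : (i < 2 * M + 1)%N -> sinh_tail M i = 0.
  by rewrite sinh_tailE addn1 ltnS leqNgt => /negPf->; rewrite andbF.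
have denE : comp_den M =1
    fps_scale (2 * M + 1)`!%:R (fps_shift (2 * M + 1) (sinh_tail M)).
  move=> i; rewrite /fps_scale /fps_shift sinh_tailE /comp_den.
  rewrite [(2 * M + 1)%N]addn1 addSn ltnS leq_addr andbT /= mul2n oddD.
  by rewrite odd_double; case: (odd i); rewrite ?mulr0.
move=> n; rewrite (eq_fps_mul denE (frefl _)) fps_mulC fps_mulZr /fps_scale.
have /comp_eulerP/(_ (2 * M + 1 + n)%N) := frefl (comp_euler M).
rewrite (fps_mul_order _ tail0) ltnNge leq_addr /= addKn fps_mulC => ->.
rewrite /fps_monom /fps_one -[X in _ == X]addn0 eqn_add2l.
by case: eqP => _; rewrite ?mulr0 // mulr1n divff // fact_neq0.
Qed.

(** At even i, (2N + i) (2N)! / (2N + i)! = 2N (2N - 1)! / (2N - 1 + i)!, and 2N - 1 = 2(N - 1) + 1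
    because N is positive. *)
Lemma euler_op_den N : (0 < N)%N ->
  euler_op (- (2 * N)%:R) (euler_den N) =1
  fps_scale (- (2 * N)%:R) (comp_den (N - 1)).
Proof.
case: N => // N _ i; rewrite /euler_op /fps_scale /euler_den /comp_den subn1 /=.
case: odd; first by rewrite !mulr0.
have -> : (2 * N.+1 = (2 * N + 1).+1)%N by rewrite mulnS addn1.
rewrite addSn !factS !natrM -opprD mulNr mulNr -natrD addSn; congr (- _).
have nz : (2 * N + 1 + i).+1%:R != 0 :> rat by rewrite Num.Theory.pnatr_eq0.
rewrite -!mulrA mulrCA invfM; congr (_ * _).
by rewrite mulrCA [X in _ * X]mulrA divff // mul1r.
Qed.

Lemma comp_euler_op N (E := fps_egf (hyp_euler N))
    (F := fps_egf (comp_euler (N - 1))) : (0 < N)%N ->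
  fps_mul F (euler_op (2 * N)%:R E) =1 fps_scale (2 * N)%:R (fps_mul E E).
Proof.
move=> N_gt0.
have AE : fps_mul (euler_den N) E =1 fps_one by apply/hyp_eulerP.
have EA : fps_mul E (euler_den N) =1 fps_one by move=> n; rewrite fps_mulC AE.
have FB : fps_mul F (comp_den (N - 1)) =1 fps_one.
  by move=> n; rewrite fps_mulC comp_denV.
(* The weights -2N and 2N cancel, so the Leibniz rule on A E = 1 has left side T_0 1 = 0. *)
have ATE : fps_mul (euler_den N) (euler_op (2 * N)%:R E) =1
    fps_scale (2 * N)%:R (fps_mul E (comp_den (N - 1))).
  move=> n; have := euler_opM (- (2 * N)%:R) (2 * N)%:R (euler_den N) E n.
  rewrite addNr (eq_euler_op _ _ _ AE) euler_op_one.
  rewrite (eq_fps_mul (euler_op_den _ N_gt0) (frefl E)) fps_mulC fps_mulZr.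
  by rewrite /fps_scale mulNr addrC => /esym/eqP; rewrite subr_eq0 => /eqP.
have TE : euler_op (2 * N)%:R E =1
    fps_scale (2 * N)%:R (fps_mul E (fps_mul E (comp_den (N - 1)))).
  move=> n; rewrite -fps_mulZr -(eq_fps_mul (frefl E) ATE) fps_mulA.
  by rewrite (eq_fps_mul EA (frefl _)) fps_mul1.
(* In F E (E B), the factor F cancels B and leaves E E. *)
move=> n; rewrite (eq_fps_mul (frefl F) TE) fps_mulZr; congr (_ * _).
rewrite fps_mulCA; apply: eq_fps_mul => // {}n.
by rewrite fps_mulCA fps_mulC (eq_fps_mul FB (frefl E)) fps_mul1.
Qed.

Lemma comp_euler_op2 N (E := fps_egf (hyp_euler N))
    (F := fps_egf (comp_euler (N - 1))) : (0 < N)%N ->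
  fps_mul F (euler_op (4 * N)%:R (fps_mul F (euler_op (2 * N)%:R E))) =1
  fps_scale (8 * N ^ 2)%:R (fps_mul E (fps_mul E E)).
Proof.
move=> N_gt0.
have TEE : euler_op (4 * N)%:R (fps_mul F (euler_op (2 * N)%:R E)) =1
    fps_scale (4 * N)%:R (fps_mul E (euler_op (2 * N)%:R E)).
  move=> n; rewrite (eq_euler_op _ _ _ (comp_euler_op _ N_gt0)).
  have := euler_opM (2 * N)%:R (2 * N)%:R E E n.
  (* After commuting one product, both Leibniz terms are E T_(2N) E; this doubles the factor 2N to
     4N. *)
  rewrite [X in _ = X + _]fps_mulC -natrD -mulnDl /euler_op /fps_scale mulrCA => ->.
  by rewrite !natrM; ring.
move=> n; rewrite (eq_fps_mul (frefl F) TEE) fps_mulZr {1}/fps_scale fps_mulCA.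
rewrite (eq_fps_mul (frefl E) (comp_euler_op _ N_gt0)) fps_mulZr /fps_scale !natrM; ring.
Qed.

Theorem theorem4 (N n : nat) (hN : (1 <= N)%N) :
  \sum_(i1 < n.+1) \sum_(i2 < n.+1) \sum_(i3 < n.+1 | (i1 + i2 + i3)%N == n)
     trinomial n i1 i2 i3
       * hyp_euler N i1 * hyp_euler N i2 * hyp_euler N i3
  = \sum_(0 <= m < n.+1) \sum_(0 <= k < m.+1)
      'C(n, m)%:R * 'C(m, k)%:R
        * (((4 * N)%:R - m%:R) * ((2 * N)%:R - k%:R) / (8 * N ^ 2)%:R)
        * hyp_euler N k * comp_euler (N - 1) (n - m) * comp_euler (N - 1) (m - k).
Proof.
have binE m k : (k <= m)%N ->
    'C(m, k)%:R = m`!%:R / (k`!%:R * (m - k)`!%:R) :> rat.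
  move=> le_km; rewrite -(bin_fact le_km) !natrM mulfK //.
  by rewrite mulf_neq0 ?fact_neq0.
have nzN : (8 * N ^ 2)%:R != 0 :> rat.
  by rewrite Num.Theory.pnatr_eq0 -lt0n muln_gt0 expn_gt0 hN.
transitivity (n`!%:R * fps_mul (fps_egf (hyp_euler N))
    (fps_mul (fps_egf (hyp_euler N)) (fps_egf (hyp_euler N))) n).
  rewrite fps_mul3E mulr_sumr; apply: eq_bigr => i1 _.
  rewrite mulr_sumr; apply: eq_bigr => i2 _.
  rewrite mulr_sumr; apply: eq_bigr => i3 _; rewrite /trinomial /fps_egf !natrM.
  by field; rewrite !fact_neq0.
(* The outer product is indexed by m and the inner one by k, which puts F at n - m and m - k, and E
   at k, as in the double sum. *)
apply: (mulfI nzN); rewrite mulrCA -[X in _ * X = _]comp_euler_op2 //.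
rewrite big_mkord !mulr_sumr; apply: eq_bigr => m _.
have le_mn : (m <= n)%N by rewrite -ltnS.
rewrite big_mkord /euler_op /fps_mul !mulr_sumr; apply: eq_bigr => k _.
have le_km : (k <= m)%N by rewrite -ltnS.
(* The constant is made opaque so that [field] sees it as a single nonzero atom. *)
rewrite !binE // /fps_egf; move: (8 * N ^ 2)%:R nzN => c nz_c.
by field; rewrite !fact_neq0 nz_c.
Qed.
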